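(* In the game of Knights and Spies with parameters $n$ and $\ell$, $1 \le \ell < n/2$, the Secret-Keeper has a strategy (obeying the rules of the game) which ensures that the Interrogator cannot make a successful claim before she has asked $n+\ell-1$ questions; that is, whatever questions the Interrogator asks, after any number of questions fewer than $n+\ell-1$ there are at least two different subsets of $\{1,\dots,n\}$ consistent with the answers given.
   Context: The game of Knights and Spies is played between an Interrogator and a Secret-Keeper, on $n$ people labelled $1,\dots,n$, with a parameter $\ell$, $1\le \ell<n/2$. In each turn the Interrogator asks a question of the form ''Person $i$, what is the identity of person $j$?'', and the Secret-Keeper answers ''knight'' or ''spy''. A subset $S \subseteq \{1,\dots,n\}$ (the putative set of spies) is consistent with the answers so far if $|S| \le \ell$ and, for every question asked to a person $i \notin S$ about person $j$, the answer was ''spy'' if $j\in S$ and ''knight'' if $j\notin S$ (people not in $S$ are knights, who always tell the truth; spies may answer either way). The Secret-Keeper is not committed to any particular set, but must answer so that at every point at least one consistent subset exists. At the start of a turn the Interrogator may claim by naming a set of spies; the claim succeeds if it is the unique consistent subset, otherwise the Secret-Keeper refutes it by exhibiting another consistent subset. *)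

(* Defs.v *)
From mathcomp Require Import all_boot.
Set Implicit Arguments.
Unset Strict Implicit.
Unset Printing Implicit Defensive.

(* People are the elements of 'I_n. The pair (i, j) stands for the question
   "Person i, what is the identity of person j?"; the case i = j and repeated
   questions are allowed. *)
Definition question (n : nat) : Type := ('I_n * 'I_n)%type.

(* An answer is true for "spy" and false for "knight". *)
Definition answer : Type := bool.

(* The questions asked so far with their answers, oldest first. *)
Definition history (n : nat) : Type := seq (question n * answer).

Definition consistent (n l : nat) (h : history n) (S : {set 'I_n}) : bool :=
  (#|S| <= l) &&
  all (fun qa : question n * answer =>
         let: (i, j, a) := qa in (i \notin S) ==> (a == (j \in S))) h.

Definition claim_succeeds (n l : nat) (h : history n) (S : {set 'I_n}) : Prop :=
  consistent l h S /\ forall T : {set 'I_n}, consistent l h T -> T = S.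

Definition strategy (n : nat) : Type := history n -> question n -> answer.

(* An adaptive Interrogator facing a fixed deterministic strategy asks some
   fixed list of questions, so quantifying over lists covers every way in which
   she can play. *)
Definition play (n : nat) (s : strategy n) (qs : seq (question n)) : history n :=
  foldl (fun h q => rcons h (q, s h q)) [::] qs.

(* This constrains the strategy at every stage of the game, however many
   questions are asked. *)
Definition obeys_rules (n l : nat) (s : strategy n) : Prop :=
  forall qs : seq (question n),
    exists S : {set 'I_n}, consistent l (play s qs) S.

(* Main.v *)
Require Import Defs.
From mathcomp Require Import all_boot.

(** The first [l - 1] answers are all accusations (except that a person says of
    itself that it is a knight). They join people into classes, at least
    [n - l + 1] in number. From then on the Secret-Keeper calls every member of a
    class a spy, except for the last one to be asked about, so that a set with
    exactly one knight in each class is always consistent, and it has at most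
    [l - 1] spies. If someone, say [p], has not been asked about in the second
    phase, then [p] can be the knight of its class, and can also be an extra spy;
    hence the second phase must last for [n] questions. *)

Definition merge {T : eqType} (f : T -> T) (q : T * T) (x : T) : T :=
  if f x == f q.1 then f q.2 else f x.

(** Labels for the connected components of the graph with edges [qs]: each [merge] gives the class
    of [q.1] the label of the class of [q.2]. *)
Definition class_of {T : eqType} (qs : seq (T * T)) : T -> T := foldl merge id qs.

Lemma merge_eq (T : eqType) (f : T -> T) q x y :
  f x = f y -> merge f q x = merge f q y.
Proof. by rewrite /merge => ->. Qed.

Lemma class_of_rcons (T : eqType) (qs : seq (T * T)) q :
  class_of (rcons qs q) = merge (class_of qs) q.
Proof. by rewrite /class_of -cats1 foldl_cat. Qed.

Lemma class_of_mem (T : eqType) (qs : seq (T * T)) i j :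
  (i, j) \in qs -> class_of qs i = class_of qs j.
Proof.
elim/last_ind: qs => // qs q IH; rewrite mem_rcons inE class_of_rcons.
case/orP => [/eqP <-|/IH/merge_eq->//].
by rewrite /merge /= eqxx; case: ifP.
Qed.

(** A merge can lose only the label [f q.1], so each question costs at most one class. *)
Lemma card_class_of (T : finType) (qs : seq (T * T)) :
  #|T| <= #|[set class_of qs x | x : T]| + size qs.
Proof.
elim/last_ind: qs => [|qs q IH].
  by rewrite addn0 card_imset // cardsT.
rewrite size_rcons class_of_rcons addnS -addSn; apply: leq_trans IH _.
rewrite leq_add2r; set f := class_of qs.
have sub : [set f x | x : T] \subset f q.1 |: [set merge f q x | x : T].
  apply/subsetP => _ /imsetP [x _ ->]; rewrite !inE.
  case: eqP => //= ne; apply/imsetP; exists x => //.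
  by rewrite /merge; case: eqP.
by apply: leq_trans (subset_leq_card sub) _; rewrite cardsU1; case: (_ \notin _).
Qed.

(** Here [t] sends each element to a representative of its class. The fixed points of [t] form its
    image, on which [f] is injective. *)
Lemma card_non_representatives (T : finType) (f t : T -> T) :
  (forall x, f (t x) = f x) -> (forall x y, f x = f y -> t x = t y) ->
  #|[set x | t x != x]| + #|[set f x | x : T]| = #|T|.
Proof.
move=> ft tf; have -> : #|[set f x | x : T]| = #|[set t x | x : T]|.
  have -> : [set f x | x : T] = f @: [set t x | x : T].
    by rewrite -imset_comp; apply: eq_imset => x /=; rewrite ft.
  apply: card_in_imset => _ _ /imsetP [x _ ->] /imsetP [y _ ->].
  by rewrite !ft; apply: tf.
have -> : [set t x | x : T] = ~: [set x | t x != x].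
  apply/setP => y; rewrite !inE negbK; apply/imsetP/eqP => [[x _ ->]|<-].
    by apply: tf; rewrite ft.
  by exists y.
by rewrite cardsC.
Qed.

Definition called_spy {n : nat} (h : history n) : {set 'I_n} :=
  [set k | has (fun qa => (qa.1.2 == k) && qa.2) h].

Lemma called_spy_rcons (n : nat) (h : history n) qa :
  called_spy (rcons h qa) =
  if qa.2 then qa.1.2 |: called_spy h else called_spy h.
Proof.
apply/setP => k; rewrite inE has_rcons.
by case: (qa.2); rewrite ?andbF ?andbT !inE // eq_sym.
Qed.

Definition accuse_all_but_last {n : nat} (m : nat) : strategy n := fun h q =>
  if size h < m then q.1 != q.2 else
  let f := class_of (unzip1 (take m h)) in
  [exists k, [&& k != q.2, f k == f q.2 & k \notin called_spy (drop m h)]].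

Lemma play_rcons (n : nat) (s : strategy n) qs q :
  play s (rcons qs q) = rcons (play s qs) (q, s (play s qs) q).
Proof. by rewrite /play -cats1 foldl_cat. Qed.

Lemma unzip1_play (n : nat) (s : strategy n) qs : unzip1 (play s qs) = qs.
Proof.
by elim/last_ind: qs => // qs q IH; rewrite play_rcons /unzip1 map_rcons /= -/unzip1 IH.
Qed.

Lemma size_play (n : nat) (s : strategy n) qs : size (play s qs) = size qs.
Proof. by rewrite -{2}(unzip1_play n s qs) size_map. Qed.

Section Play.
Variables (n m : nat) (qs : seq (question n)).
Let h := play (accuse_all_but_last m) qs.
Let f := class_of (unzip1 (take m h)).

Lemma answer_first_phase qa : qa \in take m h -> qa.2 = (qa.1.1 != qa.1.2).
Proof.
rewrite /h; elim/last_ind: (qs) => // r q IH.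
rewrite play_rcons; set h' := play _ r in IH *.
case: (ltnP (size h') m) => hm; last by rewrite -cats1 takel_cat.
rewrite take_oversize ?size_rcons // mem_rcons inE.
case/orP => [/eqP->|qah]; first by rewrite /= /accuse_all_but_last hm.
by apply: IH; rewrite take_oversize // ltnW.
Qed.

(** The invariant of the second phase. An answer of spy leaves another member of the class uncalled;
    an answer of knight is given only when all the others have been called spies, and [called_spy]
    never shrinks. *)
Lemma second_phase :
  (forall x, exists2 y, f y = f x & y \notin called_spy (drop m h)) /\
  (forall qa, qa \in drop m h -> ~~ qa.2 ->
     forall k, k != qa.1.2 -> f k = f qa.1.2 -> k \in called_spy (drop m h)).
Proof.
rewrite /f /h; elim/last_ind: (qs) => [|r q].
  by split=> // x; exists x; rewrite ?inE.
rewrite play_rcons; set h' := play _ r.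
case: (ltnP (size h') m) => hm.
  move=> _; rewrite [drop _ _]drop_oversize ?size_rcons //.
  by split=> // x; exists x; rewrite ?inE.
rewrite drop_rcons // -cats1 takel_cat // called_spy_rcons.
set f' := class_of _; set U := called_spy _ => -[nonspy last].
have answerE : accuse_all_but_last m h' q =
    [exists k, [&& k != q.2, f' k == f' q.2 & k \notin U]].
  by rewrite /accuse_all_but_last ltnNge hm.
rewrite answerE; case: existsP => [[k /and3P [kq /eqP fk kU]]|noU] /=.
  split=> [x|qa].
    (* If the uncalled member [y] is the person just accused, the witness [k] behind the answer
       replaces it. *)
    have [y fy yU] := nonspy x; have [yq|yq] := eqVneq y q.2.
      by exists k; rewrite ?in_setU1 ?negb_or ?kq // fk -yq.
    by exists y; rewrite ?in_setU1 ?negb_or ?yq.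
  rewrite mem_rcons inE => /orP [/eqP ->//|qah] qaF k' k'q fk'.
  by rewrite inE (last qa) // orbT.
split=> // qa; rewrite mem_rcons inE => /orP [/eqP -> /= _ k kq fk|]; last exact: last.
by apply/negP => kU; apply: noU; exists k; rewrite kq fk eqxx; apply/negP.
Qed.

Section Transversal.
Variable t : 'I_n -> 'I_n.
Hypothesis class_t : forall x, f (t x) = f x.
Hypothesis t_class : forall x y, f x = f y -> t x = t y.
Hypothesis t_nonspy : forall x, t x \notin called_spy (drop m h).

(** At most [m] merges leave at least [n - m] classes, each with one knight. *)
Lemma card_non_knights : #|[set x | t x != x]| <= m.
Proof.
have := card_class_of _ (unzip1 (take m h)).
rewrite -(card_non_representatives _ f t class_t t_class) addnC leq_add2l size_map.
by move=> le; apply: leq_trans le _; rewrite size_take_min geq_minl.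
Qed.

(** The knights are the fixed points of [t] outside [E]. A first-phase question puts [i] and [j] in
    one class, so a knight [i] rightly accuses any other [j]. In the second phase [t] avoids
    everyone called a spy, which forces [t j = j] when [j] is called a knight. *)
Lemma transversal_consistent (l : nat) (E : {set 'I_n}) :
  m + #|E| <= l -> (forall qa, qa \in drop m h -> qa.1.2 \notin E) ->
  consistent l h ([set x | t x != x] :|: E).
Proof.
move=> le_l notE; apply/andP; split.
  apply: leq_trans le_l; apply: leq_trans (leq_card_setU _ _) _.
  by rewrite leq_add2r card_non_knights.
apply/allP => -[[i j] a]; rewrite -{1}(cat_take_drop m h) mem_cat.
case/orP => [qah|qah]; apply/implyP; rewrite !inE negb_or negbK => /andP [/eqP ti iE].
  have /= -> := answer_first_phase _ qah.
  have [<-|ij] := eqVneq i j; first by rewrite ti eqxx (negbTE iE).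
  have <- : t i = t j.
    by apply/t_class/class_of_mem/mapP; exists (i, j, a).
  by rewrite ti ij.
have jE := notE _ qah; rewrite /= in jE; rewrite (negbTE jE) orbF.
have [_ last] := second_phase; case: a qah => qah.
  rewrite eq_sym eqb_id; apply: contraNneq (t_nonspy j) => ->.
  by rewrite inE; apply/hasP; exists (i, j, true); rewrite //= eqxx.
rewrite eq_sym eqbF_neg negbK; apply: contraNT (t_nonspy j) => tj.
by apply: (last _ qah) => //=; apply: class_t.
Qed.

End Transversal.

Lemma exists_transversal (p : 'I_n) : p \notin called_spy (drop m h) ->
  exists t : 'I_n -> 'I_n,
    [/\ forall x, f (t x) = f x, forall x y, f x = f y -> t x = t y,
        forall x, t x \notin called_spy (drop m h) & t p = p].
Proof.
move=> pU; have [nonspy _] := second_phase.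
(* The choice depends on [x] only through [f x]. The default of [odflt] is never reached, since
   every class has an uncalled member. *)
pose t x := if f x == f p then p else
  odflt p [pick y | (f y == f x) && (y \notin called_spy (drop m h))].
have tP x : f (t x) = f x /\ t x \notin called_spy (drop m h).
  rewrite /t; case: eqP => [->//|_]; case: pickP => [y /andP [/eqP]//|none].
  by have [y fy yU] := nonspy x; have := none y; rewrite fy eqxx yU.
exists t; split=> [x|x y fxy|x|]; try by case: (tP x).
  by rewrite /t fxy.
by rewrite /t eqxx.
Qed.

End Play.

Theorem theorem2 (n l : nat) (l_ge1 : 1 <= l) (l_lt : 2 * l < n) :
  exists s : strategy n,
    obeys_rules l s /\
    forall qs : seq (question n), size qs < n + l - 1 ->
      ~ (exists S : {set 'I_n}, claim_succeeds l (play s qs) S) /\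
      exists S T : {set 'I_n},
        [/\ S != T, consistent l (play s qs) S & consistent l (play s qs) T].
Proof.
have n_gt0 : 0 < n by apply: leq_ltn_trans l_lt.
(* Stopping the first phase at [l.-1] questions leaves room for one extra spy. *)
exists (accuse_all_but_last l.-1); split=> [qs|qs size_qs].
  have [+ _] := second_phase _ l.-1 qs => /(_ (Ordinal n_gt0)) [p _].
  case/exists_transversal => t [class_t t_class t_nonspy _].
  exists ([set x | t x != x] :|: set0).
  apply: (transversal_consistent _ l.-1) => // [|qa _]; last by rewrite inE.
  by rewrite cards0 addn0 leq_pred.
set h := play _ qs.
(* The second phase has had fewer than [n] questions, so it has missed someone. *)
have [p p_unasked] : exists p, p \notin [seq qa.1.2 | qa <- drop l.-1 h].
  apply/existsP; rewrite -negb_forall; apply/negP => /forallP all_asked.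
  have : n <= size h - l.-1.
    rewrite -size_drop -(size_map (fun qa => qa.1.2)) -{1}(card_ord n).
    apply: leq_trans (card_size _); rewrite -cardsT.
    by apply/subset_leq_card/subsetP => x _; apply: all_asked.
  rewrite size_play -{1}(prednK n_gt0) ltn_subRL leqNgt.
  by rewrite -addnS prednK // addnC -subn1 addnBA // size_qs.
have pU : p \notin called_spy (drop l.-1 h).
  rewrite inE; apply: contra p_unasked => /hasP [qa qah /andP [/eqP <- _]].
  exact: (map_f (fun qa => qa.1.2)).
have [t [class_t t_class t_nonspy tp]] := exists_transversal _ _ _ _ pU.
have consE E := transversal_consistent _ _ _ t class_t t_class t_nonspy l E.
have consS : consistent l h ([set x | t x != x] :|: set0).
  by apply: consE => [|qa _]; rewrite ?inE // cards0 addn0 leq_pred.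
have consT : consistent l h ([set x | t x != x] :|: [set p]).
  apply: consE => [|qa qah]; first by rewrite cards1 addn1 prednK.
  rewrite inE; apply: contraNneq p_unasked => <-.
  exact: (map_f (fun qa => qa.1.2)).
(* As [t p = p], person [p] is a knight in the first set and a spy in the second. *)
have neqST : [set x | t x != x] :|: set0 != [set x | t x != x] :|: [set p].
  by apply/eqP => /setP /(_ p); rewrite !inE tp !eqxx.
split; last by exists ([set x | t x != x] :|: set0), ([set x | t x != x] :|: [set p]).
by case=> S [_ uniqS]; case/eqP: neqST; rewrite (uniqS _ consS) (uniqS _ consT).
Qed.
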